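(* The class of unlabelled graphs underlying an element of $\mathcal{L}_1$ coincides with the class of (non-empty) outerplanar graphs.
   Context: Graphs are finite, undirected, without multiple edges, may have loops, have at least one vertex, and are considered up to isomorphism. A graph is outerplanar if it does not have $K_4$ or $K_{2,3}$ as a minor (equivalently, it has a planar drawing such that all its vertices lie on the same face). A $(1,1)$-bilabelled graph is a tuple $\boldsymbol{F}=(F,u,v)$ with $F$ a graph and $u,v\in V(F)$ (in-label $u$, out-label $v$; $u=v$ is allowed). $F$ is its underlying unlabelled graph. The series composition $\boldsymbol{F}\cdot\boldsymbol{F}'$ of $(F,u,v)$ and $(F',u',v')$ is obtained from the disjoint union of $F$ and $F'$ by identifying $v$ with $u'$, with in-label $u$ and out-label $v'$. The parallel composition $\boldsymbol{F}\odot\boldsymbol{F}'$ is obtained from the disjoint union by identifying $u$ with $u'$ and $v$ with $v'$, with in-label $u$ and out-label $v$. Multiple edges are removed and loops are kept. The symmetric group $\mathfrak{S}_2$ acts on bilabelled graphs by permuting labels, i.e. the non-trivial element sends $(F,u,v)$ to $(F,v,u)$. A $(1,1)$-bilabelled graph is atomic if all its vertices are labelled; $\mathcal{A}_1$ is the set of atomic $(1,1)$-bilabelled graphs. $\mathcal{L}_1$ is the class of $(1,1)$-bilabelled graphs generated by $\mathcal{A}_1$ under parallel composition with graphs from $\mathcal{A}_1$, series composition, and the action of $\mathfrak{S}_2$ on the labels. *)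

(* Defs.v *)
(** Graphs with possible loops, outerplanarity via forbidden minors, and
    (1,1)-bilabelled graphs with series and parallel composition
    (Mathematical Components). *)
From HB Require Import structures.
From mathcomp Require Import all_boot.

Set Implicit Arguments.
Unset Strict Implicit.
Unset Printing Implicit Defensive.

Local Open Scope quotient_scope.

Record graph := Graph {
  vertex :> finType;
  edge : rel vertex;
  edge_sym : symmetric edge;
  vertex_gt0 : 0 < #|vertex| }.

Definition graph_iso (G H : graph) : Prop :=
  exists2 f : G -> H, bijective f & {mono f : x y / edge x y}.

(** ** Minors *)

(** A set of vertices inducing a connected, possibly empty, subgraph. *)
Definition connected_in (G : graph) (B : {set G}) : bool :=
  [forall x in B, forall y in B,
     connect [rel a b : G | [&& a \in B, b \in B & edge a b]] x y].

(** [B] assigns a branch set to each vertex of [H]; the notion is meant for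
    loopless [H], loops of [G] are irrelevant. *)
Definition minor_model (H G : graph) (B : H -> {set G}) : Prop :=
  [/\ forall x, B x != set0,
      forall x, connected_in (B x),
      forall x y, x != y -> [disjoint B x & B y] &
      forall x y, edge x y ->
        exists a b, [/\ a \in B x, b \in B y & edge a b]].

Definition minor (H G : graph) : Prop :=
  exists B : H -> {set G}, minor_model B.

Definition complete_rel (n : nat) : rel 'I_n := fun x y => x != y.

Lemma complete_sym n : symmetric (@complete_rel n).
Proof. by move=> x y; rewrite /complete_rel eq_sym. Qed.

Lemma complete_gt0 n : 0 < #|'I_n.+1|.
Proof. by rewrite card_ord. Qed.

(** [complete n] is K_{n+1}. *)
Definition complete (n : nat) : graph :=
  Graph (@complete_sym n.+1) (complete_gt0 n).

Definition bipartite_rel (m n : nat) : rel ('I_m + 'I_n)%type :=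
  fun x y => is_inl x != is_inl y.

Lemma bipartite_sym m n : symmetric (@bipartite_rel m n).
Proof. by move=> x y; rewrite /bipartite_rel eq_sym. Qed.

Lemma bipartite_gt0 m n : 0 < #|{: 'I_m.+1 + 'I_n}|.
Proof. by rewrite card_sum !card_ord. Qed.

(** [complete_bipartite m n] is K_{m+1,n}. *)
Definition complete_bipartite (m n : nat) : graph :=
  Graph (@bipartite_sym m.+1 n) (bipartite_gt0 m n).

Definition K4 : graph := complete 3.
Definition K23 : graph := complete_bipartite 1 3.

Definition outerplanar (G : graph) : Prop := ~ minor K4 G /\ ~ minor K23 G.

(** ** Disjoint unions *)

Section DisjointUnion.
Variables G H : graph.

Definition union_edge : rel (G + H)%type := fun x y =>
  match x, y with
  | inl a, inl b => edge a b
  | inr a, inr b => edge a b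
  | _, _ => false
  end.

Lemma union_edge_sym : symmetric union_edge.
Proof. by move=> [a|a] [b|b] //=; rewrite edge_sym. Qed.

Lemma union_gt0 : 0 < #|{: G + H}|.
Proof. by rewrite card_sum addn_gt0 vertex_gt0. Qed.

Definition disjoint_union : graph := Graph union_edge_sym union_gt0.

End DisjointUnion.

(** ** Identification of vertices *)

Section Identify.
Variables (G : graph) (r : rel G).

(** The least equivalence relation containing [r]. *)
Definition ident_rel : rel G := connect [rel x y | r x y || r y x].

Lemma ident_rel_refl : reflexive ident_rel.
Proof. exact: connect0. Qed.

Lemma ident_rel_sym : symmetric ident_rel.
Proof. by apply: sym_connect_sym => x y /=; rewrite orbC. Qed.

Lemma ident_rel_trans : transitive ident_rel.
Proof. exact: connect_trans. Qed.

Canonical ident_equiv :=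
  EquivRel ident_rel ident_rel_refl ident_rel_sym ident_rel_trans.

Definition ident_vertex := {eq_quot ident_equiv}.

HB.instance Definition _ := Quotient.on ident_vertex.
HB.instance Definition _ := [Finite of ident_vertex by <:%/].

(** An edge between two identified vertices becomes a loop. *)
Definition ident_edge : rel ident_vertex := fun a b =>
  [exists x : G, exists y : G,
     [&& \pi_ident_vertex x == a, \pi_ident_vertex y == b & edge x y]].

Lemma ident_edge_sym : symmetric ident_edge.
Proof.
by move=> a b; apply/existsP/existsP => -[x /existsP[y /and3P[xa yb xy]]];
  exists y; apply/existsP; exists x; rewrite xa yb edge_sym.
Qed.

Lemma ident_gt0 : 0 < #|{: ident_vertex}|.
Proof.
have /card_gt0P[x _] := vertex_gt0 G.
by apply/card_gt0P; exists (\pi_ident_vertex x).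
Qed.

Definition identify : graph := Graph ident_edge_sym ident_gt0.

Definition ident_class (x : G) : identify := \pi_ident_vertex x.

End Identify.

(** ** (1,1)-bilabelled graphs *)

Record bilabelled := Bilabelled {
  underlying : graph;
  in_label : underlying;
  out_label : underlying }.

Definition bilabelled_iso (F F' : bilabelled) : Prop :=
  exists f : underlying F -> underlying F',
    [/\ bijective f, {mono f : x y / edge x y},
        f (in_label F) = in_label F' & f (out_label F) = out_label F'].

Definition swap_labels (F : bilabelled) : bilabelled :=
  Bilabelled (out_label F) (in_label F).

Definition atomic (F : bilabelled) : Prop :=
  forall x : underlying F, x = in_label F \/ x = out_label F.

Section Compositions.
Variables F F' : bilabelled.

Let U : graph := disjoint_union (underlying F) (underlying F').

Definition series_rel : rel U := fun x y =>
  (x == inl (out_label F)) && (y == inr (in_label F')).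

Definition series : bilabelled :=
  @Bilabelled (identify series_rel)
    (ident_class series_rel (inl (in_label F)))
    (ident_class series_rel (inr (out_label F'))).

Definition parallel_rel : rel U := fun x y =>
  (x == inl (in_label F)) && (y == inr (in_label F')) ||
  (x == inl (out_label F)) && (y == inr (out_label F')).

Definition parallel : bilabelled :=
  @Bilabelled (identify parallel_rel)
    (ident_class parallel_rel (inl (in_label F)))
    (ident_class parallel_rel (inl (out_label F))).

End Compositions.

(** The class L_1; [L1_iso] reflects that graphs are considered up to
    isomorphism. *)
Inductive L1 : bilabelled -> Prop :=
| L1_atomic F : atomic F -> L1 F
| L1_parallel F A : L1 F -> atomic A -> L1 (parallel F A)
| L1_series F F' : L1 F -> L1 F' -> L1 (series F F')
| L1_swap F : L1 F -> L1 (swap_labels F)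
| L1_iso F F' : bilabelled_iso F F' -> L1 F -> L1 F'.

(* Main.v *)
Require Import Defs.
From mathcomp Require Import all_boot zify.

(** Call an injection of the vertices into the naturals noncrossing if no two
    edges interleave. Every member of L_1 has a noncrossing layout in which the
    in-label comes first and the out-label, if different, last: series
    composition concatenates layouts, and an edge between the extremes crosses
    nothing. In a noncrossing layout two disjoint connected sets cannot
    interleave either, which rules out models of K_4 and K_{2,3}.

    Conversely, let G be outerplanar. By simultaneous induction on a set S of
    vertices, (G[S], u, z) lies in L_1 for every u in S and some z, and
    (G[S], u, v) does whenever some connected set outside S is adjacent to both
    u and v. Suppose that u has neighbours x <> v in one component of S - u, and
    choose x (in the first claim, the pair x, v) so that the component W of v in
    S - u - x is as small as possible. Then v is the only possible neighbour of
    u in W, as a further one would yield K_{2,3} or K_4; so (G[S], u, v) is, up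
    to the edge uv, the series composition of (G[S - W], u, x) and
    (G[W + x], x, v), to which induction applies. If there are no such x and v,
    then S splits into two pieces joined by at most one edge at u. *)

Set Implicit Arguments.
Unset Strict Implicit.
Unset Printing Implicit Defensive.

(** * Composing realizations of induced subgraphs *)

Section Identification.
Variables (U : graph) (r : rel U).

Lemma ident_classP (c : identify r) : exists x, c = ident_class r x.
Proof. by exists (repr c); rewrite /ident_class reprK. Qed.

Lemma ident_class_eq x y : ident_class r x = ident_class r y <-> ident_rel r x y.
Proof. by split=> [/eqmodP//|xy]; apply/eqmodP. Qed.

Lemma ident_edgeP (c d : identify r) :
  reflect (exists x y, [/\ c = ident_class r x, d = ident_class r y & edge x y])
          (edge c d).
Proof.
apply: (iffP existsP) => [[x /existsP[y /and3P[/eqP<- /eqP<- xy]]]|].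
  by exists x, y.
case=> x [y [-> -> xy]]; exists x; apply/existsP; exists y.
by rewrite /ident_class !eqxx.
Qed.

(** Both compositions are studied through such a map, into a vertex set or into [nat], rather than
    through representatives. Constancy on generating pairs suffices, as it propagates along the
    chains that make up [ident_rel]. *)
Lemma ident_lift (T : Type) (g : U -> T) :
    (forall x y, r x y -> g x = g y) ->
    (forall x y, g x = g y -> ident_rel r x y) ->
  exists2 k : identify r -> T, injective k & forall z, k (ident_class r z) = g z.
Proof.
move=> rg gr; have irg x y : ident_rel r x y -> g x = g y.
  case/connectP=> p + ->; elim: p x => //= z p IHp x /andP[xz /IHp<-].
  by case/orP: xz => /rg->.
have kE x : g (repr (ident_class r x)) = g x.
  by apply: irg; apply/ident_class_eq; rewrite /ident_class reprK.
exists (g \o repr : identify r -> T) => // c d.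
have [x ->] := ident_classP c; have [y ->] := ident_classP d.
by rewrite /= !kE => /gr/ident_class_eq.
Qed.

Lemma ident_rel1 x y : r x y -> ident_rel r x y.
Proof. by move=> xy; apply: connect1; rewrite /= xy. Qed.

End Identification.

Section Realization.
Variable T : finType.
Implicit Types (e : rel T) (S : {set T}) (u v x : T).

(* [h] identifies a member of L_1 with [(S, e)] labelled by [u] and [v]. *)
Definition realizes e S u v : Prop :=
  exists F : bilabelled, L1 F /\
  exists h : underlying F -> T,
    [/\ injective h, {mono h : x y / edge x y >-> e x y}, codom h =i S,
        h (in_label F) = u & h (out_label F) = v].

Lemma realizes_ext e e' S u v :
  {in S &, e =2 e'} -> realizes e S u v -> realizes e' S u v.
Proof.
move=> ee' [F [LF [h [hI hE hS hu hv]]]]; exists F; split=> //; exists h.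
by split=> // x y; rewrite -ee' ?hE // -hS codom_f.
Qed.

Lemma realizes_swap e S u v : realizes e S u v -> realizes e S v u.
Proof.
move=> [F [LF [h [hI hE hS hu hv]]]]; exists (swap_labels F).
by split; [apply: L1_swap | exists h].
Qed.

Lemma realizes_labels e S u v : realizes e S u v -> u \in S /\ v \in S.
Proof. by move=> [F [_ [h [_ _ hS <- <-]]]]; rewrite -!hS !codom_f. Qed.

Lemma realizes_pair e u v : symmetric e -> realizes e [set u; v] u v.
Proof.
move=> eS; pose V := {x | x \in [set u; v]}.
have uV : u \in [set u; v] by rewrite set21.
have vV : v \in [set u; v] by rewrite set22.
have VS : symmetric (fun x y : V => e (val x) (val y)) by move=> x y; apply: eS.
have V0 : 0 < #|{: V}| by apply/card_gt0P; exists (Sub u uV).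
pose F := @Bilabelled (Graph VS V0) (Sub u uV) (Sub v vV).
exists F; split; last first.
  exists val; split=> //; first exact: val_inj.
  move=> x; apply/codomP/idP=> [[y ->]|xV]; first exact: valP.
  by exists (Sub x xV).
apply: L1_atomic => x; case/set2P: (valP x) => xE; [left | right].
  exact: val_inj.
exact: val_inj.
Qed.

(** Since edges between the two sets must pass through [x], the union induces no edge that is
    missing from both factors. *)
Lemma realizes_series e S1 S2 u x v :
    symmetric e -> S1 :&: S2 = [set x] ->
    {in S1 & S2, forall a b, e a b -> a = x \/ b = x} ->
  realizes e S1 u x -> realizes e S2 x v -> realizes e (S1 :|: S2) u v.
Proof.
move=> eS S12 eX [F [LF [h [hI hE hS hu hx]]]] [F' [LF' [h' [hI' hE' hS' hx' hv]]]].
have hh' a b : h a = h' b -> a = out_label F /\ b = in_label F'.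
  move=> ab; have: h a \in S1 :&: S2 by rewrite inE -hS codom_f /= ab -hS' codom_f.
  rewrite S12 inE => /eqP hax; split; first by apply: hI; rewrite hx.
  by apply: hI'; rewrite hx' -ab.
pose U := disjoint_union (underlying F) (underlying F').
pose r := @series_rel F F'.
pose g (z : U) := match z with inl a => h a | inr b => h' b end.
have r1 : r (inl (out_label F)) (inr (in_label F')) by rewrite /r /series_rel !eqxx.
have [k kI kE] : exists2 k : identify r -> T,
    injective k & forall z, k (ident_class r z) = g z.
  apply: ident_lift.
    by move=> a b /andP[/eqP-> /eqP->] /=; rewrite hx hx'.
  move=> [a|a] [b|b] /=; rewrite -/U.
  - by move/hI->; apply: connect0.
  - by case/hh'=> -> ->; apply: ident_rel1.
  - by case/esym/hh'=> -> ->; rewrite ident_rel_sym; apply: ident_rel1.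
  - by move/hI'->; apply: connect0.
have cls : ident_class r (inl (out_label F)) = ident_class r (inr (in_label F')).
  by apply/ident_class_eq; apply: ident_rel1.
exists (series F F'); split; first exact: L1_series.
exists k; split=> //; first 1 last.
- move=> z; apply/codomP/setUP => [[c ->]|].
    by have [[a|a] ->] := ident_classP c; rewrite kE -hS -hS'; [left | right]; apply: codom_f.
  by rewrite -hS -hS' => -[] /codomP[a ->]; [exists (ident_class r (inl a))|
    exists (ident_class r (inr a))]; rewrite kE.
- by rewrite kE.
- by rewrite kE.
move=> c d; apply/idP/ident_edgeP.
  have [a ->] := ident_classP c; have [b ->] := ident_classP d; rewrite !kE.
  (* An edge across ends at the glued vertex, so it lies in one factor once [x] is read as the label
     of that factor. *)
  have XX a' b' : e (h a') (h' b') -> a' = out_label F \/ b' = in_label F'.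
    by case/eX; rewrite -?hS -?hS' ?codom_f // => E; [left; apply: hI|right; apply: hI'];
      congruence.
  case: a b => [a|a] [b|b] /= ab.
  - by exists (inl a), (inl b); rewrite /= -hE.
  - case: (XX _ _ ab) => E; rewrite E in ab *.
      by exists (inr (in_label F')), (inr b); split=> //=; rewrite -hE' hx' -hx.
    by exists (inl a), (inl (out_label F)); split=> //=; rewrite -hE hx -hx'.
  - rewrite eS in ab; case: (XX _ _ ab) => E; rewrite E in ab *.
      by exists (inr a), (inr (in_label F')); split=> //=; rewrite -hE' hx' -hx eS.
    by exists (inl (out_label F)), (inl b); split=> //=; rewrite -hE hx -hx' eS.
  - by exists (inr a), (inr b); rewrite /= -hE'.
by case=> [[a|a] [[b|b] [-> -> //=]]]; rewrite !kE /= ?hE ?hE'.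
Qed.

Definition joins u v : rel T :=
  fun a b => (a == u) && (b == v) || (a == v) && (b == u).

Definition add_edge u v e : rel T := fun a b => e a b || joins u v a b.

(** [complete 1] is K_2; with its two vertices as labels it is atomic, and parallel composition with
    it inserts just the edge between the labels. As [u != v], no vertices of [F] get merged. *)
Lemma realizes_add_edge e S u v :
  u != v -> realizes e S u v -> realizes (add_edge u v e) S u v.
Proof.
move=> uv [F [LF [h [hI hE hS hu hv]]]].
have io : in_label F != out_label F.
  by apply: contraNneq uv => io; rewrite -hu -hv io.
pose K2 := @Bilabelled (complete 1) ord0 ord_max.
have atK2 : atomic K2.
  by case=> [[|[]]] // i; [left | right]; apply: val_inj.
pose U := disjoint_union (underlying F) (complete 1).
pose r := @parallel_rel F K2.
pose g (z : U) := match z with inl a => h a | inr b => if b == ord0 then u else v end.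
have r0 : r (inl (in_label F)) (inr (ord0 : 'I_2)) by rewrite /r /parallel_rel !eqxx.
have r1 : r (inl (out_label F)) (inr (ord_max : 'I_2)).
  by rewrite /r /parallel_rel !eqxx orbT.
have hh (a : underlying F) (b : 'I_2) : h a = g (inr b) ->
    r (inl a) (inr b).
  case: b => [[|[]]] // i /=; rewrite /r /parallel_rel /= => E.
    by apply/orP; left; apply/andP; split=> //; apply/eqP; congr inl; apply: hI; rewrite E.
  by apply/orP; right; apply/andP; split=> //; apply/eqP; congr inl; apply: hI; rewrite E.
have [k kI kE] : exists2 k : identify r -> T,
    injective k & forall z, k (ident_class r z) = g z.
  apply: ident_lift.
    by move=> a b /orP[] /andP[/eqP-> /eqP->] /=.
  move=> [a|a] [b|b].
  - by move/hI->; apply: connect0.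
  - by move/hh=> ?; apply: ident_rel1.
  - by move/esym/hh=> ?; rewrite ident_rel_sym; apply: ident_rel1.
  - case: (eqVneq a b) => [->|ab /=]; first by move=> _; apply: connect0.
    case: a b ab => [[|[]]] // i [[|[]]] // j /= _ E; move: uv; rewrite E ?eqxx //.
have cl0 : ident_class r (inl (in_label F)) = ident_class r (inr (ord0 : 'I_2)).
  by apply/ident_class_eq; apply: ident_rel1.
have cl1 : ident_class r (inl (out_label F)) = ident_class r (inr (ord_max : 'I_2)).
  by apply/ident_class_eq; apply: ident_rel1.
have clP c : exists a, c = ident_class r (inl a).
  have [[a|[[|[]]] // i] ->] := ident_classP c; first by exists a.
    by exists (in_label F); rewrite cl0; congr (ident_class r (inr _)); apply: val_inj.
  by exists (out_label F); rewrite cl1; congr (ident_class r (inr _)); apply: val_inj.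
exists (parallel F K2); split; first exact: L1_parallel.
exists k; split=> //; first 1 last.
- move=> z; rewrite -hS; apply/codomP/codomP => [[c ->]|[a ->]].
    by have [a ->] := clP c; exists a; rewrite kE.
  by exists (ident_class r (inl a)); rewrite kE.
- by rewrite kE.
- by rewrite kE.
move=> c d; apply/idP/ident_edgeP.
  have [a ->] := clP c; have [b ->] := clP d; rewrite !kE /= => /orP[ab|/orP[/andP[]|/andP[]]].
  - by exists (inl a), (inl b); rewrite /= -hE.
  - rewrite -hu -hv => /eqP/hI-> /eqP/hI->.
    by exists (inr (ord0 : 'I_2)), (inr (ord_max : 'I_2)).
  - rewrite -hu -hv => /eqP/hI-> /eqP/hI->.
    by exists (inr (ord_max : 'I_2)), (inr (ord0 : 'I_2)).
rewrite /add_edge /joins.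
case=> [[a|a] [[b|b] [-> -> //=]]]; rewrite !kE /= ?hE; first by move->.
by case: a b => [[|[]]] // i [[|[]]] // j /= _; rewrite !eqxx ?orbT.
Qed.

End Realization.

(** * Gluing pieces that are separated up to the edge between the labels *)

Section Gluing.
Variables (T : finType) (e : rel T).
Hypothesis eS : symmetric e.
Implicit Types (S W : {set T}) (u v x : T).

Definition del_edge u v : rel T :=
  fun a b => e a b && ~~ joins u v a b.

Lemma del_edge_sym u v : symmetric (del_edge u v).
Proof.
by move=> a b; rewrite /del_edge /joins eS orbC [(b == u) && _]andbC [(b == v) && _]andbC.
Qed.

(** The edge between the labels can be disregarded during a construction: if [e] has it,
    [realizes_add_edge] restores it at the end. *)
Lemma realizes_del_edge u v S :
  u != v -> realizes (del_edge u v) S u v -> realizes e S u v.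
Proof.
move=> uv; case: (boolP (e u v)) => [euv /(realizes_add_edge uv)|neuv].
  apply: realizes_ext => a b _ _; rewrite /add_edge /del_edge.
  case: (boolP (joins u v a b)) => [|_]; last by rewrite andbT orbF.
  by rewrite orbT => /orP[] /andP[/eqP-> /eqP->] //; rewrite eS.
apply: realizes_ext => a b _ _; rewrite /del_edge.
case: (boolP (joins u v a b)) => [|_]; last by rewrite andbT.
by case/orP=> /andP[/eqP-> /eqP->]; rewrite andbF ?[e v u]eS; apply/esym/negbTE.
Qed.

Lemma del_edge_realizes u v S a b :
  ~~ ((u \in S) && (v \in S)) -> realizes e S a b -> realizes (del_edge u v) S a b.
Proof.
move=> uvS; apply: realizes_ext => c d cS dS; rewrite /del_edge.
case: (boolP (joins u v c d)) => [|_]; last by rewrite andbT.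
by case/orP=> /andP[/eqP cE /eqP dE]; move: uvS; rewrite -cE -dE cS dS.
Qed.

(** Without the edge [u v], the vertex [x] separates [W] from the rest of [S], so the two pieces
    compose in series at [x]. *)
Lemma realizes_glue S W u v x :
    W \subset S -> u \notin W -> x \notin W -> v \in W ->
    u != x ->
    (forall w z, w \in W -> z \in S :\: W -> e z w -> z = x \/ z = u /\ w = v) ->
    realizes e (S :\: W) u x -> realizes e (x |: W) x v -> realizes e S u v.
Proof.
move=> WS uW xW vW ux cross r1 r2.
have [uS xS] := realizes_labels r1.
have uv : u != v by apply: contraNneq uW => ->.
have xv : x != v by apply: contraNneq xW => ->.
have SE : S = (S :\: W) :|: (x |: W).
  apply/setP=> z; rewrite !inE; case: (eqVneq z x) => [->|_].
    by move: xS; rewrite inE => /andP[_ ->]; rewrite orbT.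
  by case: (boolP (z \in W)) => [/(subsetP WS)->|_] /=; rewrite ?orbF.
apply: realizes_del_edge => //; rewrite SE.
apply: (@realizes_series _ _ _ _ _ x).
- exact: del_edge_sym.
- apply/setP=> z; rewrite !inE; case: (eqVneq z x) => [->|_].
    by move: xS; rewrite inE => /andP[-> ->].
  by case: (z \in W); rewrite ?andbF.
- move=> a b aS /setU1P[->|bW]; first by right.
  case/andP=> /(cross _ _ bW aS)[->|[-> ->]]; first by move=> _; left.
  by rewrite /joins !eqxx.
- by apply: del_edge_realizes r1; rewrite !inE vW andbF.
- by apply: del_edge_realizes r2; rewrite !inE (negbTE ux) (negbTE uW).
Qed.

(** The pieces are chained through the atomic graph on [z] and [w], which has no edge between its
    two vertices once [u v] is deleted. Series composition thus acts as a disjoint union, whatever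
    [z] and [w] are. *)
Lemma realizes_gap S1 S2 u v z w :
    [disjoint S1 & S2] ->
    {in S1 & S2, forall a b, e a b -> a = u /\ b = v} ->
    realizes e S1 u z -> realizes e S2 w v -> realizes e (S1 :|: S2) u v.
Proof.
move=> dS cross r1 r2.
have [uS1 zS1] := realizes_labels r1; have [wS2 vS2] := realizes_labels r2.
have dS1 a : a \in S1 -> a \in S2 = false by move=> aS; rewrite (disjointFr dS).
have dS2 a : a \in S2 -> a \in S1 = false by move=> aS; rewrite (disjointFl dS).
have uv : u != v by apply: contraTneq uS1 => ->; rewrite dS2.
have cross' : {in S1 & S2, forall a b, del_edge u v a b = false}.
  move=> a b aS bS; rewrite /del_edge; case E: (e a b) => //.
  by case: (cross _ _ aS bS E) => -> ->; rewrite /joins !eqxx.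
apply: realizes_del_edge => //.
have -> : S1 :|: S2 = (S1 :|: [set z; w]) :|: S2.
  apply/setP=> a; rewrite !inE.
  case: (eqVneq a z) => [->|_]; first by rewrite zS1.
  by case: (eqVneq a w) => [->|_]; rewrite ?wS2 ?orbT ?orbF.
apply: (@realizes_series _ _ _ _ _ w).
- exact: del_edge_sym.
- apply/setP=> a; rewrite !inE.
  case: (eqVneq a w) => [->|]; first by rewrite wS2 !orbT.
  move=> _; case: (eqVneq a z) => [->|] /=; rewrite ?orbF; first by rewrite (dS1 z) ?andbF.
  by move=> _; apply/negP=> /andP[/dS1->].
- move=> a b aS bS; case: (boolP (a \in S1)) => [aS1|aS1].
    by rewrite cross'.
  move: aS; rewrite !inE (negbTE aS1) /= => /orP[/eqP az|/eqP->]; last by left.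
  by rewrite az zS1 in aS1.
- apply: (@realizes_series _ _ _ _ _ z).
  + exact: del_edge_sym.
  + apply/setP=> a; rewrite !inE; case: (eqVneq a z) => [->|] /=; rewrite ?zS1 //.
    by move=> _; case: (eqVneq a w) => [->|]; rewrite ?andbF // dS2.
  + move=> a b aS /set2P[->|->]; first by right.
    by rewrite cross'.
  + by apply: del_edge_realizes r1; rewrite (dS2 v) ?andbF.
  + exact/realizes_pair/del_edge_sym.
- by apply: del_edge_realizes r2; rewrite (dS1 u).
Qed.

End Gluing.

(** * Components and minors *)

Section Connectedness.
Variable G : graph.
Implicit Types (A B T : {set G}) (u v x y z : G).

Definition adj A B := [exists a in A, exists b in B, edge a b].

Lemma adjP A B : reflect (exists a b, [/\ a \in A, b \in B & edge a b]) (adj A B).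
Proof.
apply: (iffP exists_inP) => [[a aA /exists_inP[b bB ab]]|[a [b [aA bB ab]]]].
  by exists a, b.
by exists a => //; apply/exists_inP; exists b.
Qed.

Lemma adj_intro A B a b : a \in A -> b \in B -> edge a b -> adj A B.
Proof. by move=> aA bB ab; apply/adjP; exists a, b. Qed.

Lemma adj_sym A B : adj A B = adj B A.
Proof. by apply/adjP/adjP=> -[a [b [? ? ?]]]; exists b, a; rewrite edge_sym. Qed.

Lemma adjS A A' B B' : A \subset A' -> B \subset B' -> adj A B -> adj A' B'.
Proof.
by move=> /subsetP AA /subsetP BB /adjP[a [b [/AA aA /BB bB]]]; apply: adj_intro.
Qed.

Definition inside T : rel G := [rel a b | [&& a \in T, b \in T & edge a b]].

Lemma connect_ind T (P : pred G) x y :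
    (forall a b, a \in T -> b \in T -> edge a b -> P a -> P b) ->
  connect (inside T) x y -> P x -> P y.
Proof.
move=> cl /connectP[p + ->]; elim: p x => //= z p IHp x /andP[/and3P[xT zT xz] zp] Px.
by apply: IHp zp _; apply: cl xz Px.
Qed.

(** An induction principle in place of paths. Conversely, reachability inside [B] is itself a
    predicate that edges propagate. *)
Lemma connected_inP B :
  reflect (forall P : pred G,
      (forall a b, a \in B -> b \in B -> edge a b -> P a -> P b) ->
      {in B &, forall x y, P x -> P y})
    (connected_in B).
Proof.
apply: (iffP forall_inP) => [cB P cl x y xB yB|cB x xB].
  by apply: connect_ind cl _; apply: (forall_inP (cB x xB)).
apply/forall_inP => y yB; move: (connect0 (inside B) x).
apply: (cB (connect (inside B) x)) => // a b aB bB ab xa.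
by apply: connect_trans xa _; apply: connect1; rewrite /inside /= aB bB.
Qed.

Lemma connected_cut B (P : pred G) x y :
    connected_in B -> x \in B -> y \in B -> P x -> ~~ P y ->
  exists a b, [/\ a \in B, b \in B, P a, ~~ P b & edge a b].
Proof.
move=> /connected_inP cB xB yB Px Py.
have [/existsP[a /existsP[b /and5P[? ? ? ? ?]]]|] :=
  boolP [exists a, exists b, [&& a \in B, b \in B, P a, ~~ P b & edge a b]].
  by exists a, b.
rewrite negb_exists => /forallP nex; case/negP: Py; apply: cB xB yB Px => a b aB bB ab Pa.
have := nex a; rewrite negb_exists => /forallP/(_ b).
by rewrite aB bB Pa ab andbT /= negbK.
Qed.

(** The conditions that [minor_model] puts on a single branch set. *)
Definition branch B := (B != set0) && connected_in B.

Lemma branch1 x : branch [set x].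
Proof.
apply/andP; split; first by apply/set0Pn; exists x; rewrite set11.
apply/connected_inP => P _ a b.
by rewrite !inE => /eqP-> /eqP->.
Qed.

Lemma branchU A B : branch A -> branch B -> adj A B -> branch (A :|: B).
Proof.
move=> /andP[A0 /connected_inP cA] /andP[B0 /connected_inP cB] /adjP[a [b [aA bB ab]]].
apply/andP; split; first by rewrite setU_eq0 negb_and A0.
apply/connected_inP => P cl.
have clA x y : x \in A -> y \in A -> P x -> P y.
  by apply: cA => c d cA' dA; apply: cl; rewrite inE (cA', dA).
have clB x y : x \in B -> y \in B -> P x -> P y.
  by apply: cB => c d cB' dB; apply: cl; rewrite inE (cB', dB) ?orbT.
have aU : a \in A :|: B by rewrite inE aA.
have bU : b \in A :|: B by rewrite inE bB orbT.
have Pab : P a = P b by apply/idP/idP; apply: cl => //; rewrite edge_sym.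
move=> x y /setUP[xA|xB] /setUP[yA|yB]; [exact: clA | | | exact: clB] => Px.
- by apply: (clB b) => //; rewrite -Pab; apply: clA Px.
- by apply: (clA a) => //; rewrite Pab; apply: clB Px.
Qed.

(** For [v] outside [T] this is the singleton of [v]; hence the hypotheses [v \in T] below. *)
Definition component T v := [set y | connect (inside T) v y].

Lemma component_refl T v : v \in component T v.
Proof. by rewrite inE connect0. Qed.

Lemma component_sub T v : v \in T -> component T v \subset T.
Proof.
by move=> vT; apply/subsetP => y; rewrite inE => /(@connect_ind _ (mem T)); apply.
Qed.

Lemma component_closed T v y z :
  v \in T -> y \in component T v -> z \in T -> edge y z -> z \in component T v.
Proof.
move=> vT yC zT yz; have yT := subsetP (component_sub vT) _ yC.
by rewrite !inE in yC *; apply: connect_trans yC _; apply: connect1; rewrite /inside /= yT zT.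
Qed.

Lemma component_ind T v (P : pred G) :
    v \in T -> P v ->
    (forall a b, a \in component T v -> b \in component T v -> edge a b -> P a -> P b) ->
  {in component T v, forall y, P y}.
Proof.
move=> vT Pv cl y; rewrite inE => vy.
(* Membership is carried along, so that [P] has to be propagated only inside the component. *)
suff /andP[] : (y \in component T v) && P y by [].
move: (vy) => /(@connect_ind _ [pred z | (z \in component T v) && P z]); apply; last first.
  by rewrite inE /= component_refl.
move=> a b aT bT ab /andP[aC Pa]; have bC := component_closed vT aC bT ab.
by rewrite inE /= bC (cl a).
Qed.

Lemma component_branch T v : v \in T -> branch (component T v).
Proof.
move=> vT; apply/andP; split; first by apply/set0Pn; exists v; apply: component_refl.
apply/connected_inP => P cl.
suff Pv : {in component T v, forall y, P y == P v} by move=> x y /Pv/eqP-> /Pv/eqP->.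
apply: component_ind => // a b aC bC ab /eqP<-; apply/eqP; apply/idP/idP; apply: cl => //.
by rewrite edge_sym.
Qed.

(** The component is closed under edges of [T], so it absorbs every connected subset of [T] that it
    meets. *)
Lemma component_min T v B x :
  v \in T -> branch B -> B \subset T -> x \in B -> x \in component T v -> B \subset component T v.
Proof.
move=> vT /andP[_ /connected_inP cB] /subsetP BT xB xC; apply/subsetP => y yB.
apply: (cB (mem (component T v)) _ x y) => // a b aB bB ab /= aC.
by apply: component_closed ab => //; apply: BT.
Qed.

Lemma component_sym T v x : v \in T -> x \in component T v -> v \in component T x.
Proof.
move=> vT xC; have xT := subsetP (component_sub vT) _ xC.
have /subsetP -> // :=
  component_min xT (component_branch vT) (component_sub vT) xC (component_refl T x).
exact: component_refl.
Qed.

(** Otherwise the component in [T :\ x] would be closed under edges of [T] as well, and would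
    already contain [x]. *)
Lemma component_adj T v x :
  v \in T -> x \in component T v -> x != v -> adj (component (T :\ x) v) [set x].
Proof.
move=> vT xC xv; apply: contraTT xC => nadj.
have vTx : v \in T :\ x by rewrite !inE eq_sym xv.
apply/negP => xC; have : x \in component (T :\ x) v.
  apply: (component_ind (P := mem (component (T :\ x) v))) xC => //; first exact: component_refl.
  move=> a b aC bC ab /= aD; case: (eqVneq b x) => [bx|bx].
    by case/negP: nadj; apply: adj_intro ab => //; rewrite bx set11.
  by apply: component_closed ab => //; rewrite !inE bx (subsetP (component_sub vT)).
by move/(subsetP (component_sub vTx)); rewrite !inE eqxx.
Qed.

Lemma component_mono T T' v : v \in T -> T \subset T' -> component T v \subset component T' v.
Proof.
move=> vT TT'.
apply: component_min (component_branch vT) _ (component_refl _ _) (component_refl _ _).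
  exact: (subsetP TT').
exact: subset_trans (component_sub vT) TT'.
Qed.

End Connectedness.

(** * Minors from lists of branch sets *)

Section Minors.
Variable G : graph.
Implicit Types s t : seq {set G}.

(** With the branch sets in a list, all conditions unfold by computation when the list is
    explicit. *)
Lemma complete_minor n s :
    size s = n.+1 -> all (@branch G) s ->
    pairwise (fun A B : {set G} => [disjoint A & B] && adj A B) s ->
  minor (complete n) G.
Proof.
move=> sz /allP br /(pairwiseP set0) pw.
have ini (i : 'I_n.+1) : i < size s by rewrite sz.
have pwi (i j : 'I_n.+1) : i != j ->
    [disjoint nth set0 s i & nth set0 s j] && adj (nth set0 s i) (nth set0 s j).
  rewrite -val_eqE neq_ltn => /orP[ij|ji]; first by apply: pw ij; apply: ini.
  by rewrite disjoint_sym adj_sym; apply: pw ji; apply: ini.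
exists (fun i : 'I_n.+1 => nth set0 s i); split.
- by move=> i; have /andP[] := br _ (mem_nth set0 (ini i)).
- by move=> i; have /andP[] := br _ (mem_nth set0 (ini i)).
- by move=> i j /pwi/andP[].
- by move=> i j /pwi/andP[_ /adjP].
Qed.

Lemma bipartite_minor m n s t :
    size s = m.+1 -> size t = n -> all (@branch G) (s ++ t) ->
    pairwise (fun A B : {set G} => [disjoint A & B]) (s ++ t) -> allrel (@adj G) s t ->
  minor (complete_bipartite m n) G.
Proof.
move=> szs szt /allP br /(pairwiseP set0) pw /allrelP ad.
(* Positions in [s ++ t]: the second side is shifted by the length of [s]. *)
pose pos (x : 'I_m.+1 + 'I_n) : nat :=
  match x with inl i => i | inr j => m.+1 + j end.
have posI : injective pos.
  move=> [i|i] [j|j] /= E.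
  - by congr inl; apply: val_inj.
  - by have := ltn_ord i; rewrite E ltnNge leq_addr.
  - by have := ltn_ord j; rewrite -E ltnNge leq_addr.
  - by congr inr; apply: val_inj; apply/eqP; rewrite -(eqn_add2l m.+1) E.
have posL x : pos x < size (s ++ t).
  rewrite size_cat szs szt; case: x => i /=; last by rewrite ltn_add2l.
  by rewrite ltn_addr.
pose B x := nth set0 (s ++ t) (pos x).
have Bl (i : 'I_m.+1) : B (inl i) \in s.
  by rewrite /B nth_cat szs /= ltn_ord mem_nth ?szs.
have Br (i : 'I_n) : B (inr i) \in t.
  by rewrite /B nth_cat szs /= ltnNge leq_addr addKn mem_nth ?szt.
exists B; split.
- by move=> i; have /andP[] := br _ (mem_nth set0 (posL i)).
- by move=> i; have /andP[] := br _ (mem_nth set0 (posL i)).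
- move=> x y; rewrite -(inj_eq posI) neq_ltn => /orP[ij|ji]; first by apply: pw ij; apply: posL.
  by rewrite disjoint_sym; apply: pw ji; apply: posL.
- move=> [i|i] [j|j] //= _; apply/adjP; first exact: ad.
  by rewrite adj_sym; apply: ad.
Qed.

End Minors.

(** * Decomposing outerplanar graphs *)

Section Decomposition.
Variable G : graph.
Implicit Types (S T W R : {set G}) (u v x y z w p q : G).

(** The first component lies in the second and misses [q]. Against a minimal choice of the second,
    this forces [x] into the component of [p] in [T :\ q]. *)
Lemma component_card_lt T x v p q :
    v \in T :\ x -> p \in T :\ q ->
    p \in component (T :\ x) v -> q \in component (T :\ x) v -> x \notin component (T :\ q) p ->
  #|component (T :\ q) p| < #|component (T :\ x) v|.
Proof.
move=> vT pT pC qC xC; apply: proper_card; apply/properP; split; last first.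
  by exists q => //; apply: contraTN isT => /(subsetP (component_sub pT)); rewrite !inE eqxx.
apply: component_min (component_branch pT) _ (component_refl _ _) pC => //.
apply/subsetP => z zC; rewrite !inE; apply/andP; split.
  by apply: contraNneq xC => <-.
by have := subsetP (component_sub pT) _ zC; rewrite !inE => /andP[].
Qed.

Lemma component_adj2 T x y v :
    v \in T -> x \in component (T :\ y) v -> y \in component (T :\ x) v -> x != v -> y != v ->
  adj (component (T :\ x :\ y) v) [set x] /\ adj (component (T :\ x :\ y) v) [set y].
Proof.
move=> vT xC yC xv yv; split; last first.
  by apply: component_adj yC yv; rewrite !inE eq_sym xv.
have -> : T :\ x :\ y = T :\ y :\ x by apply/setP=> z; rewrite !inE andbCA.
by apply: component_adj xC xv; rewrite !inE eq_sym yv.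
Qed.

Lemma adj_set1 x y : edge x y -> adj [set x] [set y].
Proof. by apply: adj_intro; rewrite set11. Qed.

Lemma disjoint_set1 x y : x != y -> [disjoint [set x] & [set y]].
Proof. by rewrite disjoints1 inE. Qed.

Lemma disjoint_set1r T x : [disjoint T & [set x]] = (x \notin T).
Proof. by rewrite disjoint_sym disjoints1. Qed.

Lemma disjointsU R S T : [disjoint R & T] -> [disjoint S & T] -> [disjoint R :|: S & T].
Proof. by rewrite -!setI_eq0 setIUl => /eqP-> /eqP->; rewrite setU0. Qed.

(** * Configurations around a vertex that force a forbidden minor *)

Section Excluded.
Hypothesis noK23 : ~ minor K23 G.

(** The hubs are [u] and the component [W] of [v] without [x] and [y]; the leaves are [x], [y] and
    [R], which meets [W] in an edge at [v]. *)
Lemma fan_K23 S R u v x y :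
    branch R -> [disjoint R & S] -> adj R [set u] -> adj R [set v] ->
    u \in S -> v \in S :\ u -> x \in S :\ u -> y \in S :\ u ->
    x != v -> y != v -> x != y -> edge u x -> edge u y ->
  x \in component (S :\ u :\ y) v -> y \in component (S :\ u :\ x) v -> False.
Proof.
move=> bR dR Ru Rv uS vT xT yT xv yv xy ux uy xC yC; apply: noK23.
set T := S :\ u in vT xT yT xC yC.
have [Wx Wy] := component_adj2 vT xC yC xv yv.
have vT2 : v \in T :\ x :\ y by rewrite 2!inE eq_sym yv 2!inE eq_sym xv.
set W := component _ _ in Wx Wy.
have W_sub := subsetP (component_sub vT2) : {subset W <= _}.
have uT : u \notin T by rewrite !inE eqxx.
have TS z : z \in T -> z \in S by rewrite inE => /andP[].
have RS z : z \in S -> z \notin R by move=> zS; rewrite (disjointFl dR).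
have RT z : z \in T -> z \notin R by move/TS; apply: RS.
have RW : [disjoint W & R].
  by apply/pred0P => z /=; apply/negP => /andP[/W_sub]; rewrite 4!inE => /and3P[_ _ /RT/negP].
have xu : u != x by apply: contraNneq uT => ->.
have yu : u != y by apply: contraNneq uT => ->.
have uW : u \notin W by apply: contraNN uT => /W_sub; rewrite 4!inE => /and3P[].
have xW : x \notin W by apply: contraTN isT => /W_sub; rewrite !inE eqxx andbF.
have yW : y \notin W by apply: contraTN isT => /W_sub; rewrite !inE eqxx.
apply: (@bipartite_minor _ 1 3 [:: [set u]; W] [:: [set x]; [set y]; R]) => //=.
- by rewrite !branch1 bR component_branch.
- by rewrite !disjoint_set1 // !disjoint_set1r !disjoints1 uW RW xW yW (RS _ uS) !RT.
- rewrite /allrel /= !adj_set1 // Wx Wy !(adj_sym _ R) Ru.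
  by rewrite (adjS _ _ Rv) // sub1set component_refl.
Qed.

Hypothesis noK4 : ~ minor K4 G.

(** Any two of the neighbours [v], [x], [y] of [u] are linked in [S :\ u] avoiding the third. If [x]
    and [y] are adjacent, then [u], [x], [y] and the component [W] of [v] form a K_4. *)
Lemma triangle_minors S u v x y :
    u \in S -> v \in S :\ u -> x \in S :\ u -> y \in S :\ u ->
    x != v -> y != v -> x != y -> edge u x -> edge u y -> edge u v ->
    x \in component (S :\ u :\ y) v -> y \in component (S :\ u :\ x) v ->
  x \in component (S :\ u :\ v) y -> False.
Proof.
move=> uS vT xT yT xv yv xy ux uy uv xC yC xD.
set T := S :\ u in vT xT yT xC yC xD.
have [Wx Wy] := component_adj2 vT xC yC xv yv.
have vT2 : v \in T :\ x :\ y by rewrite 2!inE eq_sym yv 2!inE eq_sym xv.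
set W := component _ _ in Wx Wy.
have W_sub := subsetP (component_sub vT2) : {subset W <= _}.
have uT : u \notin T by rewrite !inE eqxx.
have nux : u != x by apply: contraNneq uT => ->.
have nuy : u != y by apply: contraNneq uT => ->.
have nuv : u != v by apply: contraNneq uT => ->.
have uW : u \notin W by apply: contraNN uT => /W_sub; rewrite 4!inE => /and3P[].
have xW : x \notin W by apply: contraTN isT => /W_sub; rewrite !inE eqxx andbF.
have yW : y \notin W by apply: contraTN isT => /W_sub; rewrite !inE eqxx.
have uWa : adj [set u] W by apply: adj_intro uv; rewrite ?set11 // component_refl.
have bW : branch W := component_branch vT2.
have [exy|nexy] := boolP (edge x y).
  apply: noK4; apply: (@complete_minor _ 3 [:: [set u]; [set x]; [set y]; W]) => //=.
    by rewrite !branch1 bW.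
  by rewrite !disjoint_set1 // !disjoints1 !adj_set1 // uW xW yW uWa !(adj_sym _ W) Wx Wy.
have yT2 : y \in T :\ v :\ x by rewrite 2!inE eq_sym xy 2!inE yv.
have yT1 : y \in T :\ v by rewrite 2!inE yv.
(* A link from [x] to [y] that avoids [v] starts at some [z] other than [y]; the component [D] of
   [z] without [v], [x], [y] then touches both [x] and [y]. *)
have /adjP[z [_ [zL /set1P-> zx]]] := component_adj yT1 xD xy.
have zy : z != y by apply: contraNneq nexy => <-; rewrite edge_sym.
have zT2 := subsetP (component_sub yT2) _ zL.
have zT3 : z \in T :\ v :\ x :\ y by rewrite in_setD1 zy.
have yz : y != z by rewrite eq_sym.
have Dy := component_adj zT2 (component_sym yT2 zL) yz.
set D := component _ _ in Dy.
have D_sub := subsetP (component_sub zT3) : {subset D <= _}.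
have bD : branch D := component_branch zT3.
have Dx : adj D [set x] by apply: adj_intro zx; rewrite ?set11 // component_refl.
have uD : u \notin D by apply: contraNN uT => /D_sub; rewrite 6!inE => /and4P[].
have xD' : x \notin D by apply: contraTN isT => /D_sub; rewrite !inE eqxx andbF.
have yD : y \notin D by apply: contraTN isT => /D_sub; rewrite !inE eqxx.
have vD : v \notin D by apply: contraTN isT => /D_sub; rewrite !inE eqxx !andbF.
(* If [D] and [W] are disjoint, contracting [D] into [y] replaces the missing edge [x y] in the
   K_4. *)
have [dDW|] := boolP [disjoint D & W].
  apply: noK4; apply: (@complete_minor _ 3 [:: [set u]; [set x]; D :|: [set y]; W]) => //=.
    by rewrite !branch1 bW branchU ?branch1.
  rewrite !disjoint_set1 // !disjoints1 !adj_set1 // uW xW uWa !(adj_sym _ W) Wx.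
  rewrite !in_setU !in_set1 (negbTE uD) (negbTE xD') (negbTE nuy) (negbTE xy) /= !andbT.
  apply/and4P; split.
  - by apply: adj_intro uy; rewrite !inE eqxx ?orbT.
  - by rewrite adj_sym; apply: adjS Dx => //; apply: subsetUl.
  - by rewrite disjointsU // disjoints1.
  - by apply: adjS Wy => //; apply: subsetUr.
(* Otherwise [D] lies in [W] and so touches [v] too: K_{2,3} with hubs [u], [D] and leaves [x], [y],
   [v]. *)
case/pred0Pn => q /= /andP[qD qW]; apply: noK23.
have DW : D \subset W.
  apply: component_min bD _ qD qW => //; apply/subsetP => a /D_sub.
  by rewrite !inE => /and4P[-> -> _].
have zW : z \in W by apply: (subsetP DW); apply: component_refl.
have vz : v != z by apply: contraNneq vD => ->; apply: component_refl.
have Dv : adj D [set v].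
  have := component_adj (W_sub _ zW) (component_sym vT2 zW) vz; rewrite /D.
  suff -> : T :\ v :\ x :\ y = T :\ x :\ y :\ v by [].
  by apply/setP=> a; rewrite !inE; do !case: (_ == _); rewrite ?andbF.
apply: (@bipartite_minor _ 1 3 [:: [set u]; D] [:: [set x]; [set y]; [set v]]) => //=.
- by rewrite !branch1 bD.
- by rewrite !disjoint_set1 // !disjoints1 !disjoint_set1r uD xD' yD vD.
- by rewrite /allrel /= !adj_set1 // Dx Dy Dv.
Qed.

End Excluded.

(** As a component of [S :\ u :\ x], [W] has no neighbours in the rest of [S] except [u] and [x]. *)
Lemma split_realizes S u x v :
    let W := component (S :\ u :\ x) v in
    u \in S -> x \in S :\ u -> v \in S :\ u :\ x ->
    {in W, forall w, edge u w -> w = v} ->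
    realizes (@edge G) (S :\: W) u x -> realizes (@edge G) (x |: W) x v ->
  realizes (@edge G) S u v.
Proof.
move=> W uS xT vT only r1 r2; have W_sub := subsetP (component_sub vT) : {subset W <= _}.
apply: realizes_glue r1 r2; first exact: edge_sym.
- by apply/subsetP => z /W_sub; rewrite !inE => /and3P[].
- by apply: contraTN isT => /W_sub; rewrite !inE eqxx andbF.
- by apply: contraTN isT => /W_sub; rewrite !inE eqxx.
- exact: component_refl.
- by rewrite eq_sym; move: xT; rewrite !inE => /andP[].
move=> w z wW; rewrite inE => /andP[zW zS] zw; case: (eqVneq z x) => [|zx]; first by left.
case: (eqVneq z u) => [zu|zu]; first by right; split=> //; apply: only; rewrite -?zu.
by case/negP: zW; apply: (component_closed vT wW); rewrite 1?edge_sym // !inE zx zu.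
Qed.

Lemma gap_realizes S u y z w :
    let W := component (S :\ u) y in
    u \in S -> y \in S :\ u -> {in W, forall w, edge u w -> w = y} ->
    realizes (@edge G) (S :\: W) u z -> realizes (@edge G) W y w ->
  realizes (@edge G) S u y.
Proof.
move=> W uS yT only r1 r2; have W_sub := subsetP (component_sub yT) : {subset W <= _}.
have -> : S = (S :\: W) :|: W.
  apply/setP=> a; rewrite in_setU in_setD.
  case: (boolP (a \in W)) => [/W_sub|_] /=; last by rewrite orbF.
  by rewrite inE => /andP[_ ->].
apply: realizes_gap r1 (realizes_swap r2); first exact: edge_sym.
  by rewrite disjoint_sym disjoints_subset; apply/subsetP => a; rewrite in_setC in_setD => ->.
move=> a b; rewrite inE => /andP[aW aS] bW ab.
case: (eqVneq a u) => [au|au]; first by split=> //; apply: only; rewrite -?au.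
by case/negP: aW; apply: (component_closed yT bW); rewrite 1?edge_sym // !inE au.
Qed.

(** The set [R] stands for the contracted part of the graph already cut off; it is what allows the
    out-label to be prescribed. *)
Lemma outerplanar_realizes S : outerplanar G ->
  (forall u, u \in S -> exists z, realizes (@edge G) S u z) /\
  (forall u v R, u \in S -> v \in S -> u != v -> branch R -> [disjoint R & S] ->
     adj R [set u] -> adj R [set v] -> realizes (@edge G) S u v).
Proof.
move=> [noK4 noK23]; have [n] := ubnP #|S|; elim: n S => // n IHn S /ltnSE Sn.
have IHlt S' a : S' \subset S -> a \in S -> a \notin S' -> #|S'| < n.
  move=> S'S aS aS'; apply: leq_trans Sn; apply: proper_card.
  by apply/properP; split=> //; exists a.
(* Both pieces need only the first claim, since [realizes_gap] accepts arbitrary second labels. *)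
have gap u y : u \in S -> y \in S :\ u ->
    {in component (S :\ u) y, forall w, edge u w -> w = y} -> realizes (@edge G) S u y.
  move=> uS yT only; have W_sub := subsetP (component_sub yT).
  have yS : y \in S by move: yT; rewrite inE => /andP[].
  have uW : u \notin component (S :\ u) y.
    by apply: contraTN isT => /W_sub; rewrite !inE eqxx.
  have [z r1] : exists z, realizes (@edge G) (S :\: component (S :\ u) y) u z.
    by apply: (IHn _ (IHlt _ y _ _ _)).1; rewrite ?subsetDl // in_setD ?uW ?component_refl.
  have [w r2] : exists w, realizes (@edge G) (component (S :\ u) y) y w.
    apply: (IHn _ (IHlt _ u _ _ _)).1 => //; last exact: component_refl.
    by apply: subset_trans (component_sub yT) _; apply: subsetDl.
  exact: gap_realizes r1 r2.
(* Here both labels of each piece are prescribed, so each piece needs its own outer set [R1] or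
   [R2]. *)
have split u x v R1 R2 (W := component (S :\ u :\ x) v) :
    u \in S -> x \in S :\ u -> v \in S :\ u :\ x ->
    {in W, forall w, edge u w -> w = v} ->
    branch R1 -> [disjoint R1 & S :\: W] -> adj R1 [set u] -> adj R1 [set x] ->
    branch R2 -> [disjoint R2 & x |: W] -> adj R2 [set x] -> adj R2 [set v] ->
    realizes (@edge G) S u v.
  move=> uS xT vT only bR1 dR1 R1u R1x bR2 dR2 R2x R2v.
  have W_sub := subsetP (component_sub vT) : {subset W <= _}.
  have vW : v \in W := component_refl _ _.
  have uW : u \notin W by apply: contraTN isT => /W_sub; rewrite !inE eqxx andbF.
  have xW : x \notin W by apply: contraTN isT => /W_sub; rewrite !inE eqxx.
  have [xu xS] : x != u /\ x \in S by move: xT; rewrite !inE => /andP[].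
  have [vx vS] : v != x /\ v \in S by move: vT; rewrite !inE => /and3P[].
  apply: (split_realizes uS xT vT only).
    apply: (IHn _ (IHlt _ v _ _ _)).2 bR1 dR1 R1u R1x => //.
    + exact: subsetDl.
    + by rewrite in_setD vW.
    + by rewrite in_setD uW.
    + by rewrite in_setD xW.
    + by rewrite eq_sym.
  apply: (IHn _ (IHlt _ u _ _ _)).2 bR2 dR2 R2x R2v => //.
  + by apply/subsetP => a /setU1P[->//|/W_sub]; rewrite !inE => /and3P[].
  + by rewrite in_setU1 (negbTE uW) eq_sym (negbTE xu).
  + by rewrite setU11.
  + by rewrite in_setU1 vW orbT.
  + by rewrite eq_sym.
split=> [u uS|u v R uS vS uv bR dR Ru Rv]; last first.
  have vT : v \in S :\ u by rewrite !inE eq_sym uv.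
  pose cand x := [&& x != v, edge u x & x \in component (S :\ u) v].
  have [/existsP[x0 candx0]|nocand] := boolP [exists x, cand x]; last first.
    apply: gap => // w wW uw; apply/eqP; apply: contraNT nocand => wv.
    by apply/existsP; exists w; rewrite /cand wv uw wW.
  case: (arg_minnP (fun x => #|component (S :\ u :\ x) v|) candx0).
  move=> x /and3P[xv ux xC] xmin.
  have xT := subsetP (component_sub vT) _ xC.
  have vTx : v \in S :\ u :\ x by rewrite 2!inE eq_sym xv.
  have Wx := component_adj vT xC xv.
  set W := component _ _ in Wx; have vW : v \in W := component_refl _ _.
  have W_sub := subsetP (component_sub vTx) : {subset W <= _}.
  have uR : u \notin R by rewrite (disjointFl dR).
  have WR : adj R W by apply: adjS Rv => //; rewrite sub1set.
  apply: (split u x v (R :|: W) (R :|: [set u])) => //.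
  (* A further neighbour [y] in [W] would be a candidate too; by minimality the component of [v]
     without [y] contains [x], and [fan_K23] applies. *)
  - move=> y yW uy; apply/eqP; apply: contraT => yv; exfalso.
    have := W_sub _ yW; rewrite in_setD1 => /andP[yx yT].
    have candy : cand y.
      by rewrite /cand yv uy (subsetP (component_mono vTx (subsetDl _ _)) _ yW).
    have vTy : v \in S :\ u :\ y by rewrite 2!inE eq_sym yv.
    apply: (@fan_K23 noK23 S R u v x y) => //; first by rewrite eq_sym.
    apply: contraT => xCy.
    by have := component_card_lt vTx vTy vW yW xCy; rewrite ltnNge xmin.
  - by apply: branchU => //; apply: component_branch.
  - rewrite disjointsU //; first by apply: disjointWr dR; apply: subsetDl.
    by rewrite disjoints_subset; apply/subsetP => a aW; rewrite in_setC in_setD aW.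
  - by apply: adjS Ru => //; apply: subsetUl.
  - by apply: adjS Wx => //; apply: subsetUr.
  - by apply: branchU => //; apply: branch1.
  - rewrite disjointsU //.
      apply: disjointWr dR; apply/subsetP => a /setU1P[->|/W_sub].
        by move: xT; rewrite inE => /andP[].
      by rewrite !inE => /and3P[].
    rewrite disjoints1 in_setU1 negb_or; apply/andP; split.
      by move: xT; rewrite !inE eq_sym => /andP[].
    by apply: contraTN isT => /W_sub; rewrite !inE eqxx andbF.
  - by apply: adjS (adj_set1 ux) => //; apply: subsetUr.
  - by apply: adjS Rv => //; apply: subsetUl.
(* The out-label is free in this claim, so the minimum is taken over ordered pairs of neighbours. *)
pose cand (p : G * G) :=
  [&& p.1 != p.2, edge u p.1, edge u p.2, p.2 \in S :\ u & p.1 \in component (S :\ u) p.2].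
have [/existsP[p0 candp0]|nocand] := boolP [exists p : G * G, cand p]; last first.
  (* Every component of [S :\ u] now has at most one neighbour of [u]. The cases are: [u] has a
     neighbour, [S] is just [u], or any other vertex will do. *)
  have [/existsP[y /andP[yT uy]]|nonbr] := boolP [exists y, (y \in S :\ u) && edge u y].
    exists y; apply: gap => // w wW uw; apply/eqP; apply: contraNT nocand => wy.
    by apply/existsP; exists (w, y); rewrite /cand /= wy uw uy yT.
  have [S1|] := eqVneq (S :\ u) set0.
    exists u; have -> : S = [set u; u] by rewrite -(setD1K uS) S1 setU0 setUid.
    by apply: realizes_pair; apply: edge_sym.
  case/set0Pn => y yT; exists y; apply: gap => // w wW uw; case/negP: nonbr.
  by apply/existsP; exists w; rewrite uw (subsetP (component_sub yT)).
case: (arg_minnP (fun p : G * G => #|component (S :\ u :\ p.1) p.2|) candp0).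
move=> [x v] /and5P[/= xv ux uv vT xC] xmin; exists v.
have xT := subsetP (component_sub vT) _ xC.
have vTx : v \in S :\ u :\ x by rewrite 2!inE eq_sym xv.
have Wx := component_adj vT xC xv.
set W := component _ _ in Wx; have vW : v \in W := component_refl _ _.
have W_sub := subsetP (component_sub vTx) : {subset W <= _}.
(* No outer set is given, but each piece provides one for the other: [W] touches [u] and [x], and
   [u] is adjacent to [x] and [v]. *)
apply: (split u x v W [set u]) => //.
- move=> y yW uy; apply/eqP; apply: contraT => yv; exfalso.
  have := W_sub _ yW; rewrite in_setD1 => /andP[yx yT].
  have yC : y \in component (S :\ u) v := subsetP (component_mono vTx (subsetDl _ _)) _ yW.
  have vTy : v \in S :\ u :\ y by rewrite 2!inE eq_sym yv.
  have yTv : y \in S :\ u :\ v by rewrite 2!inE yv.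
  (* The two remaining links come from minimality against the pairs [(y, v)] and [(v, y)]. *)
  apply: (@triangle_minors noK23 noK4 S u v x y) => //; first by rewrite eq_sym.
    apply: contraT => xCy; have := component_card_lt vTx vTy vW yW xCy.
    by rewrite ltnNge (xmin (y, v)) // /cand /= yv uy uv vT.
  apply: contraT => xCy; have := component_card_lt vTx yTv yW vW xCy.
  by rewrite ltnNge (xmin (v, y)) // /cand /= eq_sym yv uy uv yT component_sym.
- exact: component_branch.
- by rewrite disjoints_subset; apply/subsetP => a aW; rewrite in_setC in_setD aW.
- by apply: adj_intro (_ : edge v u); rewrite ?set11 // edge_sym.
- exact: branch1.
- rewrite disjoints1 in_setU1 negb_or; apply/andP; split.
    by move: xT; rewrite !inE eq_sym => /andP[].
  by apply: contraTN isT => /W_sub; rewrite !inE eqxx andbF.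
- exact: adj_set1.
- exact: adj_set1.
Qed.

Lemma outerplanar_L1 :
  outerplanar G -> exists F, L1 F /\ graph_iso (underlying F) G.
Proof.
move=> Gop; have /card_gt0P[u _] := vertex_gt0 G.
have [z [F [LF [h [hI hE hS _ _]]]]] := (outerplanar_realizes setT Gop).1 u (in_setT u).
exists F; split=> //; exists h => //.
have hinv y : exists a, h a == y.
  by have := in_setT y; rewrite -hS => /codomP[a ->]; exists a.
apply: (@Bijective _ _ h (fun y => xchoose (hinv y))) => a; last by apply/eqP/(xchooseP (hinv a)).
by apply: hI; apply/eqP/(xchooseP (hinv (h a))).
Qed.

End Decomposition.

(** * Noncrossing layouts *)

(** Edges that share an end, and loops, never violate this. Both orientations of each edge are
    covered, as [edge] is symmetric. *)
Definition noncrossing (G : graph) (f : G -> nat) :=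
  forall a b c d : G, edge a b -> edge c d ->
    ~~ [&& f a < f c, f c < f b & f b < f d].

Definition layout (F : bilabelled) (f : underlying F -> nat) :=
  [/\ injective f, noncrossing f, forall x, f (in_label F) <= f x &
      in_label F != out_label F -> forall x, f x <= f (out_label F)].

Lemma layout_ident (U : graph) (r : rel U) (g : U -> nat) (u v : U) :
    (forall x y, r x y -> g x = g y) ->
    (forall x y, g x = g y -> ident_rel r x y) ->
    noncrossing g -> (forall x, g u <= g x) ->
    (g u != g v -> forall x, g x <= g v) ->
  exists f, @layout (Bilabelled (ident_class r u) (ident_class r v)) f.
Proof.
move=> rg gr nc gu gv; have [f fI fE] := ident_lift rg gr.
exists f; split=> //=.
- move=> a b c d /ident_edgeP[a' [b' [-> -> ab]]] /ident_edgeP[c' [d' [-> -> cd]]].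
  by rewrite !fE; apply: nc.
- by move=> c; have [x ->] := ident_classP c; rewrite !fE.
- rewrite -(inj_eq fI) !fE => uv c; have [x ->] := ident_classP c.
  by rewrite fE; apply: gv.
Qed.

Lemma layout_atomic F : atomic F -> exists f, @layout F f.
Proof.
move=> atF; exists (fun x => nat_of_bool (x != in_label F)).
have out x : x != in_label F -> x = out_label F.
  by case: (atF x) => [->|//]; rewrite eqxx.
split.
- move=> x y; case: (eqVneq x _) => [->|/out->]; case: (eqVneq y _) => [->|/out->] //.
- by move=> a b c d _ _; do 4!case: (_ != _).
- by move=> x; rewrite eqxx.
- by rewrite eq_sym => -> x; case: (_ != _).
Qed.

Lemma ltn_subl M x y : x <= M -> y <= M -> (M - x < M - y) = (y < x).
Proof. lia. Qed.

Lemma layout_swap F f : @layout F f -> exists g, @layout (swap_labels F) g.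
Proof.
move=> [fI nc fu fv]; case: (eqVneq (in_label F) (out_label F)) => [uv|uv].
  by exists f; split=> //= [x|]; rewrite -uv ?eqxx.
have le := fv uv; exists (fun x => f (out_label F) - f x).
split=> //=.
- by move=> x y E; apply: fI; rewrite -(subKn (le x)) E subKn.
(* Reflection turns the order a, c, b, d into d, b, c, a. *)
- move=> a b c d ab cd; rewrite !ltn_subl //; apply: contra (nc d c b a _ _).
  + by case/and3P=> -> -> ->.
  + by rewrite (@edge_sym (underlying F)).
  + by rewrite (@edge_sym (underlying F)).
- by move=> x; rewrite subnn.
- by move=> _ x; apply: leq_sub2l.
Qed.

Lemma exists_bound (T : finType) (f : T -> nat) : exists N, forall x, f x < N.
Proof. by exists (\max_x f x).+1 => x; rewrite ltnS leq_bigmax. Qed.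

Lemma min_lt (T : eqType) (f : T -> nat) u :
  injective f -> (forall x, f u <= f x) -> forall x, x != u -> f u < f x.
Proof. by move=> fI fu x xu; rewrite ltn_neqAle fu (inj_eq fI) eq_sym xu. Qed.

Lemma max_lt (T : eqType) (f : T -> nat) u :
  injective f -> (forall x, f x <= f u) -> forall x, x != u -> f x < f u.
Proof. by move=> fI fu x xu; rewrite ltn_neqAle fu (inj_eq fI) xu. Qed.

(** If an edge of [G] and one of [H] interleave, then each has an end strictly between the ends of
    the other, so excluding either kind of nesting is enough. *)
Lemma noncrossing_union (G H : graph) (g : disjoint_union G H -> nat) :
    noncrossing (fun x : G => g (inl x)) -> noncrossing (fun y : H => g (inr y)) ->
    (forall (x x' : G) (y : H), ~~ (g (inl x) < g (inr y) < g (inl x'))) \/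
    (forall (y y' : H) (x : G), ~~ (g (inr y) < g (inl x) < g (inr y'))) ->
  noncrossing g.
Proof.
move=> nc nc' sep [a|a] [b|b] [c|c] [d|d] //= ab cd; [exact: nc | | | exact: nc'].
- case: sep => sep; first by apply: contra (sep a b c) => /and3P[-> -> _].
  by apply: contra (sep c d b) => /and3P[_ -> ->].
- case: sep => sep; first by apply: contra (sep c d b) => /and3P[_ -> ->].
  by apply: contra (sep a b c) => /and3P[-> -> _].
Qed.

Lemma layout_series_with F F' (g : underlying F + underlying F' -> nat) :
    injective (g \o inl) -> injective (g \o inr) ->
    g (inl (out_label F)) = g (inr (in_label F')) ->
    (forall x y, g (inl x) = g (inr y) -> x = out_label F /\ y = in_label F') ->
    @noncrossing (disjoint_union (underlying F) (underlying F')) g ->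
    (forall x, g (inl (in_label F)) <= g x) ->
    (g (inl (in_label F)) != g (inr (out_label F')) ->
     forall x, g x <= g (inr (out_label F'))) ->
  exists f, @layout (series F F') f.
Proof.
move=> gIl gIr gm glr nc gu gv.
have r1 : ident_rel (series_rel (F':=F')) (inl (out_label F)) (inr (in_label F')).
  by apply: ident_rel1; rewrite /series_rel !eqxx.
apply: (@layout_ident _ (@series_rel F F') g (inl (in_label F)) (inr (out_label F'))) => //;
  first by move=> x y /andP[/eqP-> /eqP->].
move=> [x|x] [y|y].
- by move/gIl->; apply: connect0.
- by case/glr=> -> ->.
- by case/esym/glr=> -> ->; rewrite ident_rel_sym.
- by move/gIr->; apply: connect0.
Qed.

(** Moving the first vertex to the end is a rotation of the cyclic order, which preserves
    noncrossing. *)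
Lemma layout_rotate F f : @layout F f -> in_label F = out_label F ->
  exists g : underlying F -> nat,
    [/\ injective g, noncrossing g & forall x, g x <= g (in_label F)].
Proof.
move=> [fI nc fu _] uv; have [K fK] := exists_bound f; have lt := min_lt fI fu.
exists (fun x => if x == in_label F then K else f x); split.
- move=> x y /=; case: eqVneq => [->|_]; case: eqVneq => [->|_] // E; last exact: fI.
    by have := fK y; rewrite E ltnn.
  by have := fK x; rewrite E ltnn.
- move=> a b c d ab cd; apply/negP.
  have ne x y : (if x == in_label F then K else f x) < (if y == in_label F then K else f y) ->
      x != in_label F.
    by case: eqVneq => // _; case: eqVneq => _; rewrite ?ltnn // ltnNge ltnW.
  move=> /and3P[/= ac cb bd]; move: (ne _ _ ac) (ne _ _ cb) (ne _ _ bd).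
  move: ac cb bd => + + + /negbTE au /negbTE cu /negbTE bu; rewrite au cu bu.
  case: eqVneq => [dE|_] ac cb bd; last first.
    by have := nc a b c d ab cd; rewrite ac cb bd.
  (* If [d] is the moved vertex, the original order was d, a, c, b. *)
  by rewrite edge_sym in cd; have /negP[] := nc d c a b cd ab; rewrite ac cb dE lt ?au.
- by move=> x; rewrite eqxx; case: eqVneq => // _; rewrite ltnW.
Qed.

Lemma layout_series F F' f f' :
  @layout F f -> @layout F' f' -> exists g, @layout (series F F') g.
Proof.
move=> lF lF'; have [fI nc fu fv] := lF; have [fI' nc' fu' fv'] := lF'.
have [N fN] := exists_bound f.
case: (boolP ((in_label F == out_label F) || (in_label F' != out_label F'))) => uv.
  have lt' := min_lt fI' fu'.
  (* The layout of [F'] follows that of [F], except that the glued vertex keeps its place in [F],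
     where it is first or last. *)
  pose g z := match z with inl x => f x
    | inr y => if y == in_label F' then f (out_label F) else N + f' y end.
  have far x y : f x < N + y by apply: leq_trans (fN x) (leq_addr _ _).
  have g_mono x y : g (inr x) < g (inr y) -> f' x < f' y.
    rewrite /=; case: eqVneq => [->|_]; case: eqVneq => [->|yu].
    - by rewrite ltnn.
    - by rewrite lt'.
    - by rewrite ltnNge ltnW ?far.
    - by rewrite ltn_add2l.
  apply: (@layout_series_with _ _ g).
  - exact: fI.
  - move=> x y /=; case: eqVneq => [->|xu]; case: eqVneq => [->|yu] // E.
    + by have := far (out_label F) (f' y); rewrite E ltnn.
    + by have := far (out_label F) (f' x); rewrite -E ltnn.
    + exact/fI'/(addnI E).
  - by rewrite /= eqxx.
  - move=> x y /=; case: eqVneq => [-> /fI-> //|_ E].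
    by have := far x (f' y); rewrite E ltnn.
  - apply: noncrossing_union => //.
      move=> a b c d ab cd; apply: contra (nc' a b c d ab cd).
      by case/and3P=> /g_mono-> /g_mono-> /g_mono->.
    left=> x x' y; rewrite /g; case: eqVneq => _; last first.
      by apply/negP => /andP[_]; rewrite ltnNge ltnW ?far.
    case: (eqVneq (in_label F) (out_label F)) => [<-|ne].
      by rewrite ltnNge fu.
    by rewrite andbC ltnNge fv.
  - move=> [x|y] /=; first exact: fu.
    by case: eqVneq => _; rewrite ?fu // ltnW ?far.
  - rewrite /=; case: (eqVneq (out_label F') (in_label F')) uv => [_|nuv uv] /=.
      by rewrite orbF => /eqP->; rewrite eqxx.
    move=> _ [x|y] /=; first by rewrite ltnW ?far.
    case: eqVneq => _; first by rewrite ltnW ?far.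
    by rewrite leq_add2l fv' // eq_sym.
(* Now the glued vertex is the out-label of the composition and has to come last: [F'] is rotated
   first, and the glued vertex takes its place in [F']. *)
move: uv; rewrite negb_or negbK => /andP[uv /eqP uv'].
have [h [hI nch hmax]] := layout_rotate lF' uv'.
have lt := max_lt fI (fv uv).
pose m := N + h (in_label F').
pose g z := match z with inl x => if x == out_label F then m else f x
  | inr y => N + h y end.
have far x y : f x < N + y by apply: leq_trans (fN x) (leq_addr _ _).
have g_mono x y : g (inl x) < g (inl y) -> f x < f y.
  rewrite /=; case: eqVneq => [->|xv]; case: eqVneq => [->|yv].
  - by rewrite ltnn.
  - by rewrite ltnNge ltnW ?far.
  - by rewrite lt.
  - by [].
apply: (@layout_series_with _ _ g).
- move=> x y /=; case: eqVneq => [->|xu]; case: eqVneq => [->|yu] // E.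
  + by have := far y (h (in_label F')); rewrite -/m E ltnn.
  + by have := far x (h (in_label F')); rewrite -/m E ltnn.
  + exact: fI.
- by move=> x y /addnI/hI.
- by rewrite /= eqxx.
- move=> x y /=; case: eqVneq => [-> /addnI/hI-> //|_ E].
  by have := far x (h y); rewrite E ltnn.
- apply: noncrossing_union.
  + move=> a b c d ab cd; apply: contra (nc a b c d ab cd).
    by case/and3P=> /g_mono-> /g_mono-> /g_mono->.
  + by move=> a b c d ab cd; rewrite !ltn_add2l; apply: nch.
  + right=> y y' x; rewrite /g; case: eqVneq => _.
      by rewrite andbC ltnNge leq_add2l hmax.
    by rewrite ltnNge ltnW ?far.
- rewrite /= (negbTE uv) => -[x|y] /=; last by rewrite ltnW ?far.
  by case: eqVneq => _; rewrite ?fu // ltnW ?far.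
- move=> _ [x|y] /=; rewrite -uv' ?leq_add2l ?hmax //.
  by case: eqVneq => _ //; rewrite ltnW ?far.
Qed.

Lemma two_values_noncrossing (p q : nat) (a b c d : bool) :
  let h (x : bool) := if x then p else q in
  ~~ [&& h a < h c, h c < h b & h b < h d].
Proof. by case: a b c d => [] [] [] [] /=; lia. Qed.

Lemma layout_parallel F A f : @layout F f -> atomic A -> exists g, @layout (parallel F A) g.
Proof.
move=> [fI nc fu fv] atA.
set u := in_label F in fu fv *; set v := out_label F in fv *.
pose uA := in_label A; pose vA := out_label A.
have Aout y : y != uA -> y = vA by case: (atA y) => -> //; rewrite eqxx.
have ru : ident_rel (@parallel_rel F A) (inl u) (inr uA).
  by apply: ident_rel1; rewrite /parallel_rel !eqxx.
have rv : ident_rel (@parallel_rel F A) (inl v) (inr vA).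
  by apply: ident_rel1; rewrite /parallel_rel !eqxx orbT.
have ruC := ru; rewrite ident_rel_sym in ruC.
have rvC := rv; rewrite ident_rel_sym in rvC.
(* In this case no vertices of [F] are merged: [A] lands on the labels and adds at most loops and an
   edge between the extremes. *)
case: (boolP ((uA != vA) || (u == v))) => [ne|].
  pose g z := match z with inl x => f x | inr y => if y == uA then f u else f v end.
  have gvA : g (inr vA) = f v.
    by rewrite /=; case: eqVneq ne => //= _ /eqP->.
  apply: (@layout_ident _ (@parallel_rel F A) g (inl u) (inl v)).
  - by move=> x y /orP[] /andP[/eqP-> /eqP->]; rewrite ?gvA //= eqxx.
  - move=> [x|x] [y|y] /=.
    + by move/fI->; apply: connect0.
    + by case: eqVneq => [-> /fI->|/Aout-> /fI->].
    + by case: eqVneq => [-> /fI<-|/Aout-> /fI<-].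
    + case: eqVneq => [->|/Aout->]; case: eqVneq => [->|/Aout->] // E;
        try exact: connect0.
      * by apply: ident_rel_trans ruC _; rewrite (fI _ _ E).
      * by apply: ident_rel_trans rvC _; rewrite (fI _ _ E).
  - apply: noncrossing_union => //.
      by move=> a b c d _ _; apply: two_values_noncrossing.
    left=> x x' y; rewrite /g; case: eqVneq => _; first by rewrite ltnNge fu.
    case: (eqVneq u v) => [<-|uv]; first by rewrite ltnNge fu.
    by rewrite andbC ltnNge fv.
  - by move=> [x|y] /=; rewrite ?fu //; case: eqVneq => _; rewrite ?fu.
  - rewrite /= => E; have uv : u != v by apply: contraNneq E => ->.
    by move=> [x|y] /=; rewrite ?fv //; case: eqVneq => _; rewrite ?fv.
(* Here [A] is a single vertex, which merges the distinct labels of [F]; [v] moves from the last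
   place to the place of [u]. *)
rewrite negb_or negbK => /andP[/eqP uvA uv].
have lt2 := max_lt fI (fv uv).
pose g (z : underlying F + underlying A) :=
  match z with inl x => if x == v then f u else f x | inr y => f u end.
have Auniq y : y = uA by apply/eqP; apply: contraT => yu; move: (yu); rewrite (Aout _ yu) -uvA eqxx.
apply: (@layout_ident _ (@parallel_rel F A) g (inl u) (inl v)).
- move=> x y /orP[] /andP[/eqP-> /eqP->] /=; last by rewrite eqxx.
  by rewrite (negbTE uv).
- have glr x : g (inl x) = f u -> ident_rel (@parallel_rel F A) (inl x) (inr uA).
    by rewrite /=; case: eqVneq => [-> _|_ /fI->] //; rewrite uvA.
  move=> [x|x] [y|y]; rewrite ?(Auniq x) ?(Auniq y).
  + move=> E; have [xu|xu] := eqVneq (g (inl x)) (f u).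
      apply: ident_rel_trans (glr _ xu) _.
      by rewrite ident_rel_sym; apply: glr; rewrite -E.
    have xv : x != v by apply: contraNneq xu => ->; rewrite /= eqxx.
    have yv : y != v by apply: contraNneq xu => yv; rewrite E yv /= eqxx.
    by move: E; rewrite /= (negbTE xv) (negbTE yv) => /fI->; apply: connect0.
  + exact: glr.
  + by move/esym/glr; rewrite ident_rel_sym.
  + by move=> _; apply: connect0.
- have gu x : f u <= g (inl x) by rewrite /=; case: eqVneq.
  apply: noncrossing_union => //.
  + move=> a b c d ab cd; apply/negP => /and3P[ac cb bd].
    have ne x y : g (inl x) < g (inl y) -> y != v.
      by move=> xy; apply: contraTneq xy => -> /=; rewrite eqxx ltnNge (gu x).
    move: (ne _ _ ac) (ne _ _ cb) (ne _ _ bd) => cv bv dv.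
    move: ac cb bd; rewrite /= (negbTE cv) (negbTE bv) (negbTE dv).
    case: eqVneq => [av|_] ac cb bd; last by have := nc a b c d ab cd; rewrite ac cb bd.
    (* If [a] is the moved vertex [v], the original order was c, b, d, a. *)
    rewrite edge_sym in ab; have := nc c d b a cd ab; rewrite cb bd av lt2 //.
  + by move=> a b c d _ _; rewrite /= ltnn.
  + by left=> x x' y; rewrite [g (inr y)]/= ltnNge gu.
- by move=> [x|y] /=; rewrite (negbTE uv) //; case: eqVneq.
- by rewrite /= (negbTE uv) eqxx eqxx.
Qed.

Lemma layout_iso F F' f : bilabelled_iso F F' -> @layout F f -> exists g, @layout F' g.
Proof.
move=> [h [[k hk kh] hE hu hv]] [fI nc fu fv].
have kE : {mono k : x y / edge x y} by move=> x y; rewrite -hE !kh.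
exists (f \o k); split=> /=.
- by apply: inj_comp => //; apply: can_inj kh.
- by move=> a b c d ab cd; apply: nc; rewrite kE.
- by move=> x; rewrite -hu hk.
- by move=> uv x; rewrite -hv hk fv // -(inj_eq (can_inj hk)) hu hv.
Qed.

Lemma L1_layout F : L1 F -> exists f, @layout F f.
Proof.
elim=> {F} [F|F A _ [f lF]|F F' _ [f lF] _ [f' lF']|F _ [f lF]|F F' iso _ [f lF]].
- exact: layout_atomic.
- exact: layout_parallel lF.
- exact: layout_series lF lF'.
- exact: layout_swap lF.
- exact: layout_iso iso lF.
Qed.

(** * Minors of noncrossing graphs *)

Section NoncrossingMinors.

(* For [c] distinct from [a] and [b]: [c] lies strictly between them. *)
Definition between (a b c : nat) := (a < c) != (b < c).

Definition crossing (a b c d : nat) := [&& a < c, c < b & b < d].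

(** The eight excluded patterns are the orientations of the two pairs, with either pair starting
    first. *)
Lemma crossing_between (a b c d : nat) :
    a != c -> a != d -> b != c -> b != d ->
    ~~ crossing a b c d -> ~~ crossing a b d c ->
    ~~ crossing b a c d -> ~~ crossing b a d c ->
    ~~ crossing c d a b -> ~~ crossing c d b a ->
    ~~ crossing d c a b -> ~~ crossing d c b a ->
  between a b c = between a b d.
Proof. rewrite /crossing /between; lia. Qed.

Lemma between_swap (a b c d : nat) :
    a != c -> a != d -> b != c -> b != d ->
  between a b c = between a b d -> between c d a = between c d b.
Proof. rewrite /between; lia. Qed.

(** For K_4: among the three ways to pair up four points on a line, first with third and second with
    fourth interleaves. *)
Lemma four_points_between (p q r s : nat) : uniq [:: p; q; r; s] ->
    between p q r = between p q s -> between p r q = between p r s ->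
  between p s q = between p s r -> False.
Proof. rewrite /= !inE /between; lia. Qed.

(** For K_{2,3}: on a circle, [p] and [q] bound two arcs, one of which contains two leaves. In the
    order p, x, y, q, for instance, the pairs [p], [y] and [x], [q] interleave. *)
Lemma five_points_between (p q x y z : nat) : uniq [:: p; q; x; y; z] ->
    between p x q = between p x y -> between p x q = between p x z ->
    between p y q = between p y x -> between p y q = between p y z ->
    between p z q = between p z x -> between p z q = between p z y ->
  False.
Proof. rewrite /= !inE /between; lia. Qed.

Variables (G : graph) (f : G -> nat).
Hypotheses (fI : injective f) (nc : noncrossing f).
Implicit Types B C : {set G}.

Lemma edge_between a b c d : edge a b -> edge c d ->
    a != c -> a != d -> b != c -> b != d ->
  between (f a) (f b) (f c) = between (f a) (f b) (f d).
Proof.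
move=> ab cd ac ad bc bd; have ba : edge b a by rewrite edge_sym.
have dc : edge d c by rewrite edge_sym.
by apply: crossing_between; rewrite ?(inj_eq fI) //; apply: nc.
Qed.

(* If [B] jumped over exactly one of [c1], [c2], then so would an edge of [C]
   over [b1], [b2], and then an edge of [B] would cross that edge. *)
Lemma branch_between B C b1 b2 c1 c2 :
    branch B -> branch C -> [disjoint B & C] ->
    b1 \in B -> b2 \in B -> c1 \in C -> c2 \in C ->
  between (f b1) (f b2) (f c1) = between (f b1) (f b2) (f c2).
Proof.
move=> /andP[_ cB] /andP[_ cC] dBC b1B b2B c1C c2C.
have ne b c : b \in B -> c \in C -> b != c.
  by move=> bB cC'; apply: contraTneq bB => ->; rewrite (disjointFl dBC).
have fne b c : b \in B -> c \in C -> f b != f c.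
  by move=> bB cC'; rewrite (inj_eq fI) ne.
have [//|/eqP neq] := eqVneq (between (f b1) (f b2) (f c1)) (between (f b1) (f b2) (f c2)).
exfalso.
pose P c := between (f b1) (f b2) (f c) == between (f b1) (f b2) (f c1).
have [c [c' [cC' c'C /eqP cE /negP c'E cc']]] :
    exists c c', [/\ c \in C, c' \in C, P c, ~~ P c' & edge c c'].
  by apply: (connected_cut cC c1C c2C); rewrite /P // eq_sym; apply/eqP.
apply: c'E; rewrite /P -cE eq_sym; apply/eqP.
apply: between_swap; rewrite 1?eq_sym ?fne //.
pose Q b := between (f c) (f c') (f b) == between (f c) (f c') (f b1).
have [//|b2E] := eqVneq (between (f c) (f c') (f b1)) (between (f c) (f c') (f b2)).
have [b [b' [bB b'B /eqP bE /negP b'E bb']]] :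
    exists b b', [/\ b \in B, b' \in B, Q b, ~~ Q b' & edge b b'].
  by apply: (connected_cut cB b1B b2B); rewrite /Q // eq_sym.
case: b'E; rewrite /Q -bE eq_sym; apply/eqP; apply: edge_between => //; by rewrite eq_sym ne.
Qed.

(** One vertex is chosen from each branch set. The union of two adjacent branch sets is connected,
    so disjoint edges of [H] yield disjoint connected sets, to which [branch_between] applies. *)
Lemma minor_between (H : graph) : minor H G ->
  exists2 b : H -> nat, injective b &
    forall i j k l, edge i j -> edge k l -> uniq [:: i; j; k; l] ->
      between (b i) (b j) (b k) = between (b i) (b j) (b l).
Proof.
move=> [B [B0 cB dB eB]].
have rep i : exists x, x \in B i by apply/set0Pn.
pose b i := xchoose (rep i).
have bB i : b i \in B i := xchooseP (rep i).
have bI : injective b.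
  by move=> i j E; apply: contraTeq (bB i) => /dB dij; rewrite (disjointFl dij) // E.
have BU i j : edge i j -> branch (B i :|: B j).
  by move=> ij; apply: branchU; [rewrite /branch B0 cB.. | apply/adjP/eB].
exists (f \o b); first exact: inj_comp.
move=> i j k l ij kl; rewrite /= !inE !negb_or => /and4P[/and3P[_ ik il] /andP[jk jl] _ _].
have dU : [disjoint B i :|: B j & B k :|: B l].
  by apply: disjointsU; rewrite disjoint_sym; apply: disjointsU; apply: dB; rewrite eq_sym.
by apply: (branch_between (BU _ _ ij) (BU _ _ kl) dU); rewrite inE bB ?orbT.
Qed.

Lemma noncrossing_outerplanar : outerplanar G.
Proof.
split=> /minor_between[b bI sep].
  pose o i (i4 : i < 4) : K4 := Ordinal i4.
  apply: (@four_points_between (b (o 0 isT)) (b (o 1 isT)) (b (o 2 isT)) (b (o 3 isT)));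
    try exact: sep.
  by rewrite -[_ :: _]/(map b [:: o 0 isT; o 1 isT; o 2 isT; o 3 isT]) map_inj_uniq.
pose hub i (i2 : i < 2) : K23 := inl (Ordinal i2).
pose leaf i (i3 : i < 3) : K23 := inr (Ordinal i3).
apply: (@five_points_between (b (hub 0 isT)) (b (hub 1 isT))
  (b (leaf 0 isT)) (b (leaf 1 isT)) (b (leaf 2 isT))); try exact: sep.
by rewrite -[_ :: _]/(map b [:: hub 0 isT; hub 1 isT; leaf 0 isT; leaf 1 isT; leaf 2 isT])
  map_inj_uniq.
Qed.

End NoncrossingMinors.

Lemma L1_outerplanar (F : bilabelled) (G : graph) :
  L1 F -> graph_iso (underlying F) G -> outerplanar G.
Proof.
move=> /L1_layout[f [fI nc _ _]] [h [k hk kh] hE].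
apply: (@noncrossing_outerplanar _ (f \o k)).
  by apply: inj_comp => //; apply: can_inj kh.
by move=> a b c d ab cd; apply: nc; rewrite -hE !kh.
Qed.

Theorem theorem4p21 (G : graph) :
  (exists F : bilabelled, L1 F /\ graph_iso (underlying F) G) <->
  outerplanar G.
Proof.
split=> [[F [LF iso]]|]; first exact: L1_outerplanar LF iso.
exact: outerplanar_L1.
Qed.
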